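(* Let $\alpha$ be a unit-speed curve in Euclidean 3-space that is not a straight line, with alternative moving frame $\{N,C,W\}$ and alternative curvatures $f,g$, and let $\varphi(s,v)=\alpha(s)+v\,C(s)$ be the associated $C$-ruled surface. Then the first fundamental form of the $C$-ruled surface is $$I = E\,ds^2+2F\,ds\,dv+G\,dv^2,$$ where $$E = v^2 f^2+\cos^2\left(\int g\,ds\right)+\left(\sin\left(\int g\,ds\right)+v g\right)^2,\qquad F=-\cos\left(\int g\,ds\right),\qquad G=1.$$
   Context: Let $\alpha(s)$ be a smooth curve in Euclidean 3-space parameterized by arc length $s$; the prime denotes $d/ds$. Its Frenet frame is $T=\alpha'$, $N=(1/\kappa)T'$, $B=T\times N$, with curvature $\kappa=\|T'\|>0$ and torsion $\tau=-\langle B',N\rangle$. The alternative moving frame $\{N,C,W\}$ consists of $N$, $C=N'/\|N'\|$ and $W=(\tau T+\kappa B)/\sqrt{\kappa^2+\tau^2}$; it satisfies $N'=fC$, $C'=-fN+gW$, $W'=-gC$, where the alternative curvatures are $f=\sqrt{\kappa^2+\tau^2}$ and $g=\frac{\kappa^2}{\kappa^2+\tau^2}\left(\frac{\tau}{\kappa}\right)'$. The notation $\int g\,ds$ denotes the antiderivative of $g$ equal to $\arctan(\tau/\kappa)$. The $C$-ruled surface of $\alpha$ (a curve that is not a straight line) is $\varphi(s,v)=\alpha(s)+v\,C(s)$. The coefficients of the first fundamental form are $E=\langle\varphi_s,\varphi_s\rangle$, $F=\langle\varphi_s,\varphi_v\rangle$, $G=\langle\varphi_v,\varphi_v\rangle$.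 *)

(* Defs.v *)
From HB Require Import structures.
From mathcomp Require Import all_boot all_order all_algebra.
From mathcomp Require Import all_classical all_reals all_analysis.

Set Implicit Arguments.
Unset Strict Implicit.
Unset Printing Implicit Defensive.

Import Order.TTheory GRing.Theory Num.Theory.
Import numFieldNormedType.Exports.

Local Open Scope ring_scope.

Section EuclideanSpace.
Context {R : realType}.
Implicit Types u v : 'rV[R]_3.

Definition dotp u v : R := \sum_i u 0 i * v 0 i.

(* The library norm `|u| on 'rV[R]_3 is the sup norm: it induces the usual
   topology, hence the usual derivatives, but lengths must use [enorm]. *)
Definition enorm u : R := Num.sqrt (dotp u u).

(* Indices live in 'I_3 = Z/3, so k + 1 and k + 2 are taken modulo 3. *)
Definition crossp u v : 'rV[R]_3 :=
  \row_(k < 3) (u 0 (k + 1) * v 0 (k + 2) - u 0 (k + 2) * v 0 (k + 1)).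

End EuclideanSpace.

Section Curves.
Context {R : realType}.
Implicit Types (I : set R) (alpha : R -> 'rV[R]_3).

(* Only meaningful for an open I, as the derivatives are two-sided. *)
Definition smooth_on I alpha : Prop :=
  forall (n : nat) (s : R), I s -> derivable (derive1n n alpha) s 1.

Definition unit_speed_on I alpha : Prop :=
  forall s : R, I s -> enorm (derive1 alpha s) = 1.

Definition straight_line_on I alpha : Prop :=
  exists p d : 'rV[R]_3,
    d != 0 /\ forall s : R, I s -> exists t : R, alpha s = p + t *: d.

Definition tangent alpha : R -> 'rV[R]_3 := derive1 alpha.

Definition curvature alpha (s : R) : R := enorm (derive1 (tangent alpha) s).

Definition normal alpha (s : R) : 'rV[R]_3 :=
  (curvature alpha s)^-1 *: derive1 (tangent alpha) s.

Definition binormal alpha (s : R) : 'rV[R]_3 :=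
  crossp (tangent alpha s) (normal alpha s).

Definition torsion alpha (s : R) : R :=
  - dotp (derive1 (binormal alpha) s) (normal alpha s).

Definition altC alpha (s : R) : 'rV[R]_3 :=
  (enorm (derive1 (normal alpha) s))^-1 *: derive1 (normal alpha) s.

Definition altW alpha (s : R) : 'rV[R]_3 :=
  (Num.sqrt (curvature alpha s ^+ 2 + torsion alpha s ^+ 2))^-1 *:
    (torsion alpha s *: tangent alpha s + curvature alpha s *: binormal alpha s).

Definition altf alpha (s : R) : R :=
  Num.sqrt (curvature alpha s ^+ 2 + torsion alpha s ^+ 2).

Definition altg alpha (s : R) : R :=
  curvature alpha s ^+ 2 / (curvature alpha s ^+ 2 + torsion alpha s ^+ 2)
  * derive1 (fun t => torsion alpha t / curvature alpha t) s.

(* The integral of g ds: among the antiderivatives of g = (arctan (tau/kappa))'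
   it denotes arctan (tau/kappa) itself, which fixes the constant. *)
Definition int_altg alpha (s : R) : R :=
  atan (torsion alpha s / curvature alpha s).

End Curves.

Section Surfaces.
Context {R : realType}.
Implicit Types (phi : R * R -> 'rV[R]_3) (p w : R * R).

Definition C_ruled_surface (alpha : R -> 'rV[R]_3) : R * R -> 'rV[R]_3 :=
  fun p => alpha p.1 + p.2 *: altC alpha p.1.

Definition partial_s phi p : 'rV[R]_3 := derive1 (fun s : R => phi (s, p.2)) p.1.

Definition partial_v phi p : 'rV[R]_3 := derive1 (fun v : R => phi (p.1, v)) p.2.

Definition fffE phi p : R := dotp (partial_s phi p) (partial_s phi p).
Definition fffF phi p : R := dotp (partial_s phi p) (partial_v phi p).
Definition fffG phi p : R := dotp (partial_v phi p) (partial_v phi p).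

(* The induced metric at p, as a quadratic form in the tangent vector
   w = (ds, dv) of the parameter plane. *)
Definition first_fundamental_form phi p w : R :=
  dotp ('d phi p w) ('d phi p w).

End Surfaces.

(* Main.v *)
Require Import Defs.
From mathcomp Require Import all_boot all_order all_algebra.
From mathcomp Require Import all_classical all_reals all_analysis.
From mathcomp Require Import ring.
Set Implicit Arguments.
Unset Strict Implicit.
Unset Printing Implicit Defensive.

Import Order.TTheory GRing.Theory Num.Theory.
Import numFieldNormedType.Exports.
Local Open Scope ring_scope.

(** Both partial derivatives of phi (s, v) = alpha s + v C s have simple
    coordinates in the orthonormal frame (N, C, W), from which E, F and G are
    read off.

    Put theta = arctan (tau / kappa).  Since kappa > 0, the identities
    cos theta = kappa / f and sin theta = tau / f hold, so the Frenet equation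
    N' = - kappa T + tau B says that (C, W) is the mirror image of (T, B) under
    a reflection of the plane orthogonal to N ([altC_frenet], [altW_frenet]):
      C = - cos theta T + sin theta B,   W = sin theta T + cos theta B.
    Conversely T = - cos theta C + sin theta W ([tangent_altframe]).
    Differentiating the formula for C, and using theta' = g
    ([int_altg_derive]), gives C' = - f N + g W ([altC_derive]).  Hence
      phi_s = T + v C' = - v f N - cos theta C + (sin theta + v g) W,
      phi_v = C.

    That E ds^2 + 2 F ds dv + G dv^2 is the squared length of the differential
    of phi follows by bilinearity from the differentiability of phi as a map
    of two variables ([first_fundamental_formE]).

    The Frenet equations only involve derivatives up to alpha'''.  The
    torsion is defined through B', but as B' = T x N' it equals N' . B, which
    is the component of N' along B ([torsion_normal]); and N' . B is
    alpha''' . B / kappa, so that tau is differentiable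
    ([torsion_derivable]). *)

(** * Dot and cross products in dimension three *)

Section VectorAlgebra.
Context {R : realType}.
Implicit Types (u v w x t n b : 'rV[R]_3) (a c : R).

Lemma row3P u v :
  u 0 0 = v 0 0 -> u 0 1 = v 0 1 -> u 0 2 = v 0 2 -> u = v.
Proof.
move=> h0 h1 h2; apply/rowP => -[[|[|[|//]]] Hi].
- by rewrite (_ : Ordinal Hi = 0)//; exact: val_inj.
- by rewrite (_ : Ordinal Hi = 1)//; exact: val_inj.
- by rewrite (_ : Ordinal Hi = 2)//; exact: val_inj.
Qed.

Lemma dotp3E u v : dotp u v = u 0 0 * v 0 0 + u 0 1 * v 0 1 + u 0 2 * v 0 2.
Proof.
rewrite /dotp !big_ord_recl big_ord0 addr0 addrA.
by do ![congr (_ + _) | congr (_ * _)]; congr (_ 0 _); exact: val_inj.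
Qed.

Lemma crossp3E u v : ((crossp u v 0 0 = u 0 1 * v 0 2 - u 0 2 * v 0 1) *
  (crossp u v 0 1 = u 0 2 * v 0 0 - u 0 0 * v 0 2) *
  (crossp u v 0 2 = u 0 0 * v 0 1 - u 0 1 * v 0 0))%type.
Proof.
have e10 : (1 + 2 : 'I_3) = 0 by exact: val_inj.
have e11 : (1 + 1 : 'I_3) = 2 by exact: val_inj.
have e21 : (2 + 1 : 'I_3) = 0 by exact: val_inj.
have e22 : (2 + 2 : 'I_3) = 1 by exact: val_inj.
by rewrite /crossp !mxE !add0r e10 e11 e21 e22.
Qed.

Lemma dotpC u v : dotp u v = dotp v u.
Proof. by rewrite !dotp3E; ring. Qed.

Lemma dotp_ge0 u : 0 <= dotp u u.
Proof. by apply: sumr_ge0 => i _; rewrite -expr2 sqr_ge0. Qed.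

Lemma dotpDl u v w : dotp (u + v) w = dotp u w + dotp v w.
Proof. by rewrite !dotp3E !mxE; ring. Qed.

Lemma dotpZl a u w : dotp (a *: u) w = a * dotp u w.
Proof. by rewrite !dotp3E !mxE; ring. Qed.

Lemma dotpDr u v w : dotp w (u + v) = dotp w u + dotp w v.
Proof. by rewrite !(dotpC w) dotpDl. Qed.

Lemma dotpZr a u w : dotp w (a *: u) = a * dotp w u.
Proof. by rewrite !(dotpC w) dotpZl. Qed.

Lemma crossp_self u : crossp u u = 0.
Proof. by apply: row3P; rewrite !crossp3E !mxE; ring. Qed.

Lemma crosspZl a u v : crossp (a *: u) v = a *: crossp u v.
Proof. by apply: row3P; rewrite !(crossp3E, mxE); ring. Qed.

Lemma crosspZr a u v : crossp u (a *: v) = a *: crossp u v.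
Proof. by apply: row3P; rewrite !(crossp3E, mxE); ring. Qed.

Lemma crosspDr u v w : crossp u (v + w) = crossp u v + crossp u w.
Proof. by apply: row3P; rewrite !(crossp3E, mxE); ring. Qed.

Lemma dotp_crossp_l u v : dotp u (crossp u v) = 0.
Proof. by rewrite dotp3E !crossp3E; ring. Qed.

Lemma dotp_crossp_r u v : dotp v (crossp u v) = 0.
Proof. by rewrite dotp3E !crossp3E; ring. Qed.

Lemma triple_product_swap u v w : dotp (crossp u v) w = - dotp v (crossp u w).
Proof. by rewrite !dotp3E !crossp3E; ring. Qed.

Lemma double_crossp u v w :
  crossp u (crossp v w) = dotp u w *: v - dotp u v *: w.
Proof. by apply: row3P; rewrite ?(crossp3E, mxE, dotp3E); ring. Qed.

Lemma lagrange_identity u v :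
  dotp (crossp u v) (crossp u v) = dotp u u * dotp v v - dotp u v ^+ 2.
Proof. by rewrite !dotp3E !crossp3E; ring. Qed.

(** Cramer's rule in the basis (u, v, u x v), with the Gram determinant of
    (u, v), which is |u x v|^2, as common denominator.  It needs no hypothesis
    on u and v, so it is a polynomial identity in the coordinates. *)
Lemma gram_decomposition u v x (b := crossp u v) :
  dotp b b *: x =
    (dotp v v * dotp x u - dotp u v * dotp x v) *: u +
    (dotp u u * dotp x v - dotp u v * dotp x u) *: v + dotp x b *: b.
Proof. by rewrite /b; apply: row3P; rewrite !(crossp3E, mxE, dotp3E); ring. Qed.

Definition orthonormal3 u v w : Prop :=
  [/\ dotp u u = 1, dotp v v = 1 & dotp w w = 1] /\
  [/\ dotp u v = 0, dotp u w = 0 & dotp v w = 0].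

Lemma orthonormal3_crossp u v :
  dotp u u = 1 -> dotp v v = 1 -> dotp u v = 0 -> orthonormal3 u v (crossp u v).
Proof.
move=> uu vv uv; split; split=> //.
- by rewrite lagrange_identity uu vv uv; ring.
- exact: dotp_crossp_l.
- exact: dotp_crossp_r.
Qed.

Lemma orthonormal3_expansion u v x : orthonormal3 u v (crossp u v) ->
  x = dotp x u *: u + dotp x v *: v + dotp x (crossp u v) *: crossp u v.
Proof.
move=> [[uu vv bb] [uv _ _]]; rewrite -[LHS]scale1r -bb gram_decomposition.
by rewrite uu vv uv !mul1r !mul0r !subr0.
Qed.

Lemma dotp_orthonormal3 u v w a1 a2 a3 c1 c2 c3 : orthonormal3 u v w ->
  dotp (a1 *: u + a2 *: v + a3 *: w) (c1 *: u + c2 *: v + c3 *: w) =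
    a1 * c1 + a2 * c2 + a3 * c3.
Proof.
move=> [[uu vv ww] [uv uw vw]].
rewrite !(dotpDl, dotpDr, dotpZl, dotpZr) uu vv ww uv uw vw.
by rewrite (dotpC v u) uv (dotpC w u) uw (dotpC w v) vw; ring.
Qed.

End VectorAlgebra.

(** * Differentiation of vector-valued functions *)

Section VectorCalculus.
Context {R : realType}.
Implicit Types (u w : R -> 'rV[R]_3) (k : R -> R) (s : R).

Lemma is_derive_derive1 (V : normedModType R) (f : R -> V) s :
  derivable f s 1 -> is_derive s 1 f (derive1 f s).
Proof. by rewrite derive1E; exact: derivableP. Qed.

Lemma is_derive1_val (V : normedModType R) (f : R -> V) s df :
  is_derive s 1 f df -> derive1 f s = df.
Proof. by move=> fE; rewrite derive1E derive_val. Qed.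

(** Derivatives depend only on germs: an identity between functions that is
    known on the open set I may be differentiated at a point of I. *)
Lemma is_derive_eq_on (V : normedModType R) (I : set R) (f g : R -> V) s df :
  open I -> I s -> (forall t, I t -> f t = g t) ->
  is_derive s 1 f df -> is_derive s 1 g df.
Proof.
move=> I_open Is fg; apply: near_eq_is_derive.
by apply: filterS fg _; exact: open_nbhs_nbhs.
Qed.

(** Product rules for vectors reduce to those for scalars through this
    coordinatewise characterization. *)
Lemma is_derive_rowP u s du : is_derive s 1 u du <->
  forall i, is_derive s 1 (fun t => u t 0 i) (du 0 i).
Proof.
split=> [ud i|ud].
  have ud1 : derivable u s 1 by [].
  have ui : derivable (fun t => u t 0 i) s 1.
    exact: (derivable_mxP u s 1).1 ud1 0 i.
  apply: (@is_derive_eq _ _ _ _ _ _ _ _ (derivableP ui)).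
  have <- : 'D_1 u s = du by exact: derive_val.
  by rewrite derive_mx// mxE.
have ud1 : derivable u s 1.
  by apply/derivable_mxP => j i; rewrite ord1; exact: ex_derive.
apply: (@is_derive_eq _ _ _ _ _ _ _ _ (derivableP ud1)).
apply/rowP => i; rewrite derive_mx// mxE; exact: derive_val.
Qed.

Lemma is_derive_dotp u w s du dw : is_derive s 1 u du -> is_derive s 1 w dw ->
  is_derive s 1 (fun t => dotp (u t) (w t)) (dotp du (w s) + dotp (u s) dw).
Proof.
move=> /is_derive_rowP ud /is_derive_rowP wd.
have -> : (fun t => dotp (u t) (w t)) =
    \sum_i ((fun t => u t 0 i) * (fun t => w t 0 i)).
  by apply/funext => t; rewrite /dotp fct_sumE.
apply: is_derive_eq.
rewrite /dotp -big_split/=; apply: eq_bigr => i _.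
by rewrite /GRing.scale/=; ring.
Qed.

Lemma is_derive_crossp u w s du dw : is_derive s 1 u du -> is_derive s 1 w dw ->
  is_derive s 1 (fun t => crossp (u t) (w t))
    (crossp du (w s) + crossp (u s) dw).
Proof.
move=> /is_derive_rowP ud /is_derive_rowP wd; apply/is_derive_rowP => i.
under eq_fun do rewrite mxE.
apply: (@is_derive_eq _ _ _
  ((fun t => u t 0 (i + 1)) * (fun t => w t 0 (i + 2)) -
   (fun t => u t 0 (i + 2)) * (fun t => w t 0 (i + 1)))).
by rewrite !mxE /GRing.scale/=; ring.
Qed.

Lemma is_derive_scale k u s dk du : is_derive s 1 k dk -> is_derive s 1 u du ->
  is_derive s 1 (fun t => k t *: u t) (dk *: u s + k s *: du).
Proof.
move=> kd /is_derive_rowP ud; apply/is_derive_rowP => i.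
under eq_fun do rewrite mxE.
apply: (@is_derive_eq _ _ _ (k * (fun t => u t 0 i))).
by rewrite !mxE /GRing.scale/=; ring.
Qed.

Lemma is_derive_enorm u s du : 0 < enorm (u s) -> is_derive s 1 u du ->
  is_derive s 1 (fun t => enorm (u t)) (dotp (u s) du / enorm (u s)).
Proof.
move=> u_gt0 ud; have uu_gt0 : 0 < dotp (u s) (u s) by rewrite -sqrtr_gt0.
have := is_derive1_comp (f := Num.sqrt)
  (is_derive1_sqrt uu_gt0) (is_derive_dotp ud ud).
move/is_derive_eq; apply; rewrite (dotpC du) -/(enorm _).
by field; rewrite gt_eqF.
Qed.

End VectorCalculus.

(** * Cosine and sine of an arctangent of a ratio *)

Section Trigonometry.
Context {R : realType}.
Implicit Types x y s : R.

(** The positivity of x makes (x, y) a point of the right half plane, where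
    arctan (y / x) is its polar angle. *)
Lemma cos_atan_ratio x y : 0 < x ->
  cos (atan (y / x)) = x / Num.sqrt (x ^+ 2 + y ^+ 2).
Proof.
move=> x_gt0.
have <- : x ^+ 2 * (1 + (y / x) ^+ 2) = x ^+ 2 + y ^+ 2.
  by field; rewrite gt_eqF.
rewrite cos_atan sqrtrM ?sqr_ge0// sqrtr_sqr gtr0_norm// invfM mulrA.
rewrite divff ?mul1r//.
by rewrite gt_eqF.
Qed.

Lemma sin_atan_ratio x y : 0 < x ->
  sin (atan (y / x)) = y / Num.sqrt (x ^+ 2 + y ^+ 2).
Proof.
move=> x_gt0; have cos_gt0 : cos (atan (y / x)) != 0.
  rewrite cos_atan_ratio// mulf_neq0 ?gt_eqF// invr_gt0 sqrtr_gt0.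
  by rewrite ltr_pwDl ?sqr_ge0// exprn_gt0.
have := atanK (y / x); rewrite /tan => /(canRL (divfK cos_gt0)) ->.
by rewrite cos_atan_ratio// mulrA divfK// gt_eqF.
Qed.

End Trigonometry.

(** * The Frenet frame and the alternative frame *)

Section AlternativeFrame.
Context {R : realType} (I : set R) (alpha : R -> 'rV[R]_3).
Context (I_open : open I) (alpha_smooth : smooth_on I alpha)
  (alpha_unit : unit_speed_on I alpha)
  (kappa_gt0 : forall s : R, I s -> 0 < curvature alpha s).
Implicit Types s v : R.

Local Notation T := (tangent alpha).
Local Notation N := (normal alpha).
Local Notation B := (binormal alpha).
Local Notation C := (altC alpha).
Local Notation W := (altW alpha).
Local Notation kappa := (curvature alpha).
Local Notation tau := (torsion alpha).
Local Notation theta := (int_altg alpha).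
Local Notation f := (altf alpha).
Local Notation g := (altg alpha).

Lemma is_derive_derive1n n s : I s ->
  is_derive s 1 (derive1n n alpha) (derive1n n.+1 alpha s).
Proof. by move=> Is; exact/is_derive_derive1/alpha_smooth. Qed.

(** Applied to the constant dot products of the frame vectors, this yields
    the skew-symmetry of the Frenet equations. *)
Lemma derive_const_on (V : normedModType R) (h : R -> V) (c : V) s dh :
  I s -> (forall t, I t -> h t = c) -> is_derive s 1 h dh -> dh = 0.
Proof.
move=> Is hc hd; rewrite -(is_derive1_val hd); apply: is_derive1_val.
by apply: (is_derive_eq_on I_open Is (f := cst c)) => t It; rewrite hc.
Qed.

Lemma tangent_unit s : I s -> dotp (T s) (T s) = 1.
Proof.
move=> Is; have /(congr1 (fun x => x ^+ 2)) := alpha_unit Is.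
by rewrite expr1n sqr_sqrtr ?dotp_ge0.
Qed.

Lemma tangent_derive1 s : I s -> derive1 T s = kappa s *: N s.
Proof. by move=> Is; rewrite scalerA divff ?scale1r// gt_eqF ?kappa_gt0. Qed.

Lemma tangent_derive s : I s -> is_derive s 1 T (kappa s *: N s).
Proof.
by move=> Is; rewrite -(tangent_derive1 Is); exact: (is_derive_derive1n 1).
Qed.

Lemma normal_unit s : I s -> dotp (N s) (N s) = 1.
Proof.
move=> /kappa_gt0 k_gt0; rewrite dotpZl dotpZr.
have k2 : dotp (derive1 T s) (derive1 T s) = kappa s ^+ 2.
  by rewrite sqr_sqrtr ?dotp_ge0.
by rewrite k2; field; rewrite gt_eqF.
Qed.

Lemma tangent_normal s : I s -> dotp (T s) (N s) = 0.
Proof.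
move=> Is; have Td := tangent_derive Is.
have := derive_const_on Is tangent_unit (is_derive_dotp Td Td).
rewrite dotpZl dotpZr (dotpC (N s)) => /eqP.
rewrite -mulr2n mulrn_eq0/= mulf_eq0 gt_eqF ?kappa_gt0//= => /eqP //.
Qed.

Lemma frenet_orthonormal s : I s -> orthonormal3 (T s) (N s) (B s).
Proof.
move=> Is; apply: orthonormal3_crossp.
- exact: tangent_unit.
- exact: normal_unit.
- exact: tangent_normal.
Qed.

Lemma curvature_derivable s : I s -> derivable kappa s 1.
Proof.
move=> Is; have := is_derive_enorm (kappa_gt0 Is) (is_derive_derive1n 2 Is).
by move=> ?; exact: ex_derive.
Qed.

(** As T' is alpha'' and kappa = |alpha''| is positive, N = alpha'' / kappa is a
    quotient of differentiable functions. *)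
Lemma normal_derivable s : I s -> derivable N s 1.
Proof.
move=> Is.
have kVd : is_derive s 1 (fun t => (kappa t)^-1)
    (derive1 (fun t => (kappa t)^-1) s).
  apply/is_derive_derive1/derivableV; first by rewrite gt_eqF ?kappa_gt0.
  exact: curvature_derivable.
have := is_derive_scale kVd (is_derive_derive1n 2 Is).
by move=> ?; exact: ex_derive.
Qed.

(** The term T' x N of the product rule vanishes because T' is a multiple
    of N. *)
Lemma binormal_derive_normal s : I s ->
  is_derive s 1 B (crossp (T s) (derive1 N s)).
Proof.
move=> Is.
have := is_derive_crossp (tangent_derive Is)
  (is_derive_derive1 (normal_derivable Is)).
by rewrite crosspZl crossp_self scaler0 add0r.
Qed.

(** Substitute B' = T x N' in tau = - B' . N and permute the factors of the
    triple product. *)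
Lemma torsion_normal s : I s -> tau s = dotp (derive1 N s) (B s).
Proof.
move=> Is; rewrite /torsion (is_derive1_val (binormal_derive_normal Is)).
by rewrite triple_product_swap opprK.
Qed.

(** The coordinates of N' in the Frenet frame: differentiating N . N = 1 and
    T . N = 0 gives the components along N and T; the one along B is tau. *)
Lemma normal_derive s : I s ->
  is_derive s 1 N (- kappa s *: T s + tau s *: B s).
Proof.
move=> Is; have Nd := is_derive_derive1 (normal_derivable Is).
apply: (@is_derive_eq _ _ _ _ _ _ _ _ Nd).
have := derive_const_on Is normal_unit (is_derive_dotp Nd Nd).
rewrite (dotpC (N s)) => /eqP; rewrite -mulr2n mulrn_eq0/= => /eqP dNN.
have := derive_const_on Is tangent_normal
  (is_derive_dotp (tangent_derive Is) Nd).
rewrite dotpZl normal_unit// mulr1 dotpC => /eqP.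
rewrite addrC addr_eq0 => /eqP dNT.
rewrite [LHS](orthonormal3_expansion _ (frenet_orthonormal Is)) dNT dNN.
by rewrite torsion_normal// scale0r addr0.
Qed.

Lemma binormal_derive s : I s -> is_derive s 1 B (- tau s *: N s).
Proof.
move=> Is; apply: (@is_derive_eq _ _ _ _ _ _ _ _ (binormal_derive_normal Is)).
rewrite (is_derive1_val (normal_derive Is)) crosspDr !crosspZr crossp_self.
rewrite scaler0 add0r double_crossp tangent_normal// tangent_unit//.
by rewrite scale0r sub0r scale1r scalerN -scaleNr.
Qed.

(** Differentiating T' = kappa N once more gives
    alpha''' = kappa' N + kappa N', whose component along B is kappa tau.  Thus
    tau = alpha''' . B / kappa, a combination of functions whose
    differentiability is known, although N'' is not yet available. *)
Lemma torsion_derivable s : I s -> derivable tau s 1.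
Proof.
move=> Is.
have tauE t : I t -> (kappa t)^-1 * dotp (derive1n 3 alpha t) (B t) = tau t.
  move=> It; have k_neq0 : kappa t != 0 by rewrite gt_eqF ?kappa_gt0.
  have Nd := is_derive_derive1 (normal_derivable It).
  have kN := is_derive_scale (is_derive_derive1 (curvature_derivable It)) Nd.
  have A2 : is_derive t 1 (derive1 T) (derive1n 3 alpha t).
    exact: (is_derive_derive1n 2).
  have A3 : derive1 (derive1 T) t =
      derive1 kappa t *: N t + kappa t *: derive1 N t.
    apply: is_derive1_val; apply: (is_derive_eq_on I_open It _ kN) => r Ir.
    by rewrite tangent_derive1.
  have [_ [_ _ NB]] := frenet_orthonormal It.
  rewrite -(is_derive1_val A2) A3 dotpDl (dotpZl _ (N t)) NB mulr0 add0r.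
  by rewrite dotpZl -torsion_normal// mulKf.
have dB := is_derive_dotp (is_derive_derive1n 3 Is) (binormal_derive Is).
have dk : derivable (fun t => (kappa t)^-1) s 1.
  by apply: derivableV; [rewrite gt_eqF ?kappa_gt0|exact: curvature_derivable].
have dp :
    derivable (fun t => (kappa t)^-1 * dotp (derive1n 3 alpha t) (B t)) s 1.
  exact: (derivableM dk (@ex_derive _ _ _ _ _ _ _ dB)).
have := is_derive_eq_on I_open Is tauE (is_derive_derive1 dp).
by move=> ?; exact: ex_derive.
Qed.

Lemma altf_gt0 s : I s -> 0 < f s.
Proof.
by move=> Is; rewrite sqrtr_gt0 ltr_pwDl ?sqr_ge0// exprn_gt0// kappa_gt0.
Qed.

Lemma cos_int_altg s : I s -> cos (theta s) = kappa s / f s.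
Proof. by move=> Is; rewrite cos_atan_ratio// kappa_gt0. Qed.

Lemma sin_int_altg s : I s -> sin (theta s) = tau s / f s.
Proof. by move=> Is; rewrite sin_atan_ratio// kappa_gt0. Qed.

(** By the chain rule theta' = (tau / kappa)' / (1 + (tau / kappa)^2), and
    clearing denominators gives the factor kappa^2 / (kappa^2 + tau^2). *)
Lemma int_altg_derive s : I s -> is_derive s 1 theta (g s).
Proof.
move=> Is; have k_gt0 := kappa_gt0 Is.
have dq : derivable (fun t => tau t / kappa t) s 1.
  apply: derivableM; first exact: torsion_derivable.
  by apply: derivableV; [rewrite gt_eqF|exact: curvature_derivable].
have := is_derive1_comp (g := fun t => tau t / kappa t)
  (is_derive1_atan (tau s / kappa s)) (is_derive_derive1 dq).
move/is_derive_eq; apply; rewrite /altg; congr (_ * _).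
have n0 : kappa s ^+ 2 + tau s ^+ 2 != 0.
  by rewrite gt_eqF// ltr_pwDl ?sqr_ge0// exprn_gt0.
field; rewrite n0 gt_eqF//= addrC; exact: n0.
Qed.

(** By the Frenet equation for N, the vector N' has length
    f = sqrt (kappa^2 + tau^2); dividing by it turns the coefficients kappa and
    tau into cos theta and sin theta. *)
Lemma altC_frenet s : I s ->
  C s = - cos (theta s) *: T s + sin (theta s) *: B s.
Proof.
move=> Is; have f_gt0 := altf_gt0 Is.
have dN : derive1 N s = - kappa s *: T s + 0 *: N s + tau s *: B s.
  by rewrite scale0r addr0; exact/is_derive1_val/normal_derive.
have nN : enorm (derive1 N s) = f s.
  rewrite /enorm dN (dotp_orthonormal3 _ _ _ _ _ _ (frenet_orthonormal Is)).
  by rewrite mulr0 addr0 mulrNN -!expr2.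
rewrite /altC nN dN scale0r addr0 scalerDr !scalerA.
rewrite cos_int_altg// sin_int_altg//.
by rewrite mulrN ![_ / f s]mulrC.
Qed.

Lemma altW_frenet s : I s ->
  W s = sin (theta s) *: T s + cos (theta s) *: B s.
Proof.
move=> Is; rewrite /altW -/(altf alpha s) cos_int_altg// sin_int_altg//.
by rewrite scalerDr !scalerA ![_ / f s]mulrC.
Qed.

Lemma tangent_altframe s : I s ->
  T s = - cos (theta s) *: C s + sin (theta s) *: W s.
Proof.
move=> Is; rewrite altC_frenet// altW_frenet// !scalerDr !scalerA.
have cs := cos2Dsin2 (theta s).
rewrite addrACA -!scalerDl mulrNN -!expr2 cs scale1r.
by rewrite (mulrC (sin _)) mulNr addNr scale0r addr0.
Qed.

Lemma altframe_orthonormal s : I s -> orthonormal3 (N s) (C s) (W s).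
Proof.
move=> Is; have TNB := frenet_orthonormal Is.
have cs := sin2cos2 (theta s).
have -> : N s = 0 *: T s + 1 *: N s + 0 *: B s.
  by rewrite !scale0r scale1r add0r addr0.
have -> : C s = - cos (theta s) *: T s + 0 *: N s + sin (theta s) *: B s.
  by rewrite scale0r addr0 altC_frenet.
have -> : W s = sin (theta s) *: T s + 0 *: N s + cos (theta s) *: B s.
  by rewrite scale0r addr0 altW_frenet.
split; split; rewrite (dotp_orthonormal3 _ _ _ _ _ _ TNB); ring: cs.
Qed.

(** In the derivative of - cos theta T + sin theta B the terms in theta'
    recombine into theta' W, and the Frenet terms into
    - (kappa cos theta + tau sin theta) N = - f N. *)
Lemma altC_derive s : I s -> is_derive s 1 C (- f s *: N s + g s *: W s).
Proof.
move=> Is; have thd := int_altg_derive Is; have f_gt0 := altf_gt0 Is.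
have cd : is_derive s 1 (fun t => - cos (theta t)) (sin (theta s) * g s).
  have := is_derive1_comp (is_derive_cos (theta s)) thd => ?.
  by apply: is_derive_eq; rewrite mulNr opprK.
have sd : is_derive s 1 (fun t => sin (theta t)) (cos (theta s) * g s).
  exact: is_derive1_comp (is_derive_sin (theta s)) thd.
have CE t : I t -> - cos (theta t) *: T t + sin (theta t) *: B t = C t.
  by move=> It; rewrite altC_frenet.
apply: (is_derive_eq_on I_open Is CE).
have := is_deriveD (is_derive_scale cd (tangent_derive Is))
                   (is_derive_scale sd (binormal_derive Is)).
move/is_derive_eq; apply.
have fE : cos (theta s) * kappa s + sin (theta s) * tau s = f s.
  rewrite cos_int_altg// sin_int_altg//.
  have f2 : f s ^+ 2 = kappa s ^+ 2 + tau s ^+ 2.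
    by rewrite sqr_sqrtr// addr_ge0 ?sqr_ge0.
  apply: (mulIf (x := f s)); first by rewrite gt_eqF.
  by rewrite -expr2 f2; field; rewrite gt_eqF.
rewrite altW_frenet// -fE.
move: (T s) (N s) (B s) (kappa s) (tau s) (cos _) (sin _) (g s).
move=> t n b k r c x d.
by apply: row3P; rewrite !mxE; ring.
Qed.

(** ** The C-ruled surface *)

Local Notation phi := (C_ruled_surface alpha).

Lemma C_ruled_surface_partial_s s v : I s ->
  is_derive s 1 (fun t => phi (t, v))
    (- (v * f s) *: N s + - cos (theta s) *: C s
       + (sin (theta s) + v * g s) *: W s).
Proof.
move=> Is.
have alphad : is_derive s 1 alpha (T s) by exact: (is_derive_derive1n 0).
have := is_deriveD alphad
  (is_derive_scale (is_derive_cst v s 1) (altC_derive Is)).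
move/is_derive_eq; apply; rewrite (tangent_altframe Is).
move: (N s) (C s) (W s) (f s) (g s) (cos _) (sin _) => n c w a b x y.
by apply: row3P; rewrite !mxE /cst; ring.
Qed.

Lemma C_ruled_surface_partial_v s v : is_derive v 1 (fun t => phi (s, t)) (C s).
Proof.
have := is_deriveD (is_derive_cst (alpha s) v 1)
  (is_derive_scale (is_derive_id v 1) (is_derive_cst (C s) v 1)).
by move/is_derive_eq; apply; rewrite add0r scale1r scaler0 addr0.
Qed.

(** Differentiability in both variables jointly comes from the coordinates:
    v C_i(s) is a product of two differentiable real functions of (s, v). *)
Lemma C_ruled_surface_differentiable s v : I s -> differentiable phi (s, v).
Proof.
move=> Is.
have fst_diff : differentiable (fst : R * R -> R) (s, v).
  by apply: (linear_differentiable (f := fst)) => ?; exact: cvg_fst.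
have snd_diff : differentiable (snd : R * R -> R) (s, v).
  by apply: (linear_differentiable (f := snd)) => ?; exact: cvg_snd.
have alphad : differentiable alpha s.
  by apply/derivable1_diffP; exact: (@alpha_smooth 0%N s Is).
have Cd := altC_derive Is.
have -> : phi = (alpha \o fst) +
    (\sum_(i < 3) (fun p : R * R => (p.2 * C p.1 0 i) *: delta_mx 0 i)).
  apply/funext => p; rewrite /C_ruled_surface [RHS]/= fct_sumE; congr (_ + _).
  rewrite {1}[C p.1]row_sum_delta scaler_sumr.
  by apply: eq_bigr => i _; rewrite scalerA.
apply: differentiableD; first exact: differentiable_comp.
apply: differentiable_sum => i; apply: differentiableZl.
apply: differentiableM => //.
apply: (differentiable_comp (g := fun t => C t 0 i)) => //.
apply/derivable1_diffP; have Cid := (is_derive_rowP _ _ _).1 Cd i.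
exact: ex_derive.
Qed.

End AlternativeFrame.

(** * The first fundamental form in the basis of partial derivatives *)

Section FirstFundamentalForm.
Context {R : realType} (phi : R * R -> 'rV[R]_3).

(** The partial derivatives are the values of the linear map 'd phi at the two
    vectors of the canonical basis. *)
Lemma diff_partials s v ds dv : differentiable phi (s, v) ->
  'd phi (s, v) (ds, dv) =
    ds *: partial_s phi (s, v) + dv *: partial_v phi (s, v).
Proof.
move=> phid.
have phi_s : 'd phi (s, v) (1, 0) = partial_s phi (s, v).
  rewrite -(deriveE _ phid) /partial_s /derive1 /derive.
  suff -> : (fun h : R =>
      h^-1 *: ((phi \o shift (s, v)) (h *: (1, 0)) - phi (s, v))) =
    (fun h => h^-1 *: (phi (h + s, v) - phi (s, v))) by [].
  apply/funext => h /=; rewrite (_ : h *: (1, 0) + (s, v) = (h + s, v))//.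
  by congr (_, _); rewrite /= ?scaler0 ?add0r ?[_%:A]mulr1.
have phi_v : 'd phi (s, v) (0, 1) = partial_v phi (s, v).
  rewrite -(deriveE _ phid) /partial_v /derive1 /derive.
  suff -> : (fun h : R =>
      h^-1 *: ((phi \o shift (s, v)) (h *: (0, 1)) - phi (s, v))) =
    (fun h => h^-1 *: (phi (s, h + v) - phi (s, v))) by [].
  apply/funext => h /=; rewrite (_ : h *: (0, 1) + (s, v) = (s, h + v))//.
  by congr (_, _); rewrite /= ?scaler0 ?add0r ?[_%:A]mulr1.
have -> : (ds, dv) = ds *: (1, 0) + dv *: (0, 1) :> R * R.
  by congr (_, _); rewrite /= scaler0 ?addr0 ?add0r [_%:A]mulr1.
rewrite linearD; congr (_ + _).
- by rewrite -phi_s; exact: linearZ.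
- by rewrite -phi_v; exact: linearZ.
Qed.

Lemma first_fundamental_formE s v ds dv : differentiable phi (s, v) ->
  first_fundamental_form phi (s, v) (ds, dv) =
    fffE phi (s, v) * ds ^+ 2 + 2 * fffF phi (s, v) * ds * dv
      + fffG phi (s, v) * dv ^+ 2.
Proof.
move=> phid; rewrite /first_fundamental_form diff_partials// /fffE /fffF /fffG.
move: (partial_s _ _) (partial_v _ _) => x y.
by rewrite !(dotpDl, dotpDr, dotpZl, dotpZr) (dotpC y x); ring.
Qed.

End FirstFundamentalForm.

Theorem theorem3p5 (R : realType) (I : set R) (alpha : R -> 'rV[R]_3)
    (I_open : open I) (I_itv : is_interval I)
    (alpha_smooth : smooth_on I alpha)
    (alpha_unit : unit_speed_on I alpha)
    (alpha_not_line : ~ straight_line_on I alpha)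
    (kappa_gt0 : forall s : R, I s -> 0 < curvature alpha s) :
  forall s v : R, I s ->
    let phi := C_ruled_surface alpha in
    let f := altf alpha s in
    let g := altg alpha s in
    let theta := int_altg alpha s in
    let E := fffE phi (s, v) in
    let F := fffF phi (s, v) in
    let G := fffG phi (s, v) in
    [/\ forall ds dv : R,
          first_fundamental_form phi (s, v) (ds, dv) =
            E * ds ^+ 2 + 2 * F * ds * dv + G * dv ^+ 2,
        E = v ^+ 2 * f ^+ 2 + cos theta ^+ 2 + (sin theta + v * g) ^+ 2,
        F = - cos theta &
        G = 1].
Proof.
move=> s v Is phi f g theta E F G.
have NCW := altframe_orthonormal I_open alpha_smooth alpha_unit kappa_gt0 Is.
have phi_s : partial_s phi (s, v) = - (v * f) *: normal alpha s +
    - cos theta *: altC alpha s + (sin theta + v * g) *: altW alpha s.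
  apply: is_derive1_val.
  exact: C_ruled_surface_partial_s
    I_open alpha_smooth alpha_unit kappa_gt0 _ _ Is.
have phi_v : partial_v phi (s, v) =
    0 *: normal alpha s + 1 *: altC alpha s + 0 *: altW alpha s.
  rewrite !scale0r scale1r add0r addr0.
  exact/is_derive1_val/C_ruled_surface_partial_v.
split.
- move=> ds dv; apply: first_fundamental_formE.
  exact: C_ruled_surface_differentiable
    I_open alpha_smooth alpha_unit kappa_gt0 _ _ Is.
- by rewrite /E /fffE phi_s (dotp_orthonormal3 _ _ _ _ _ _ NCW); ring.
- by rewrite /F /fffF phi_s phi_v (dotp_orthonormal3 _ _ _ _ _ _ NCW); ring.
- by rewrite /G /fffG phi_v (dotp_orthonormal3 _ _ _ _ _ _ NCW); ring.
Qed.
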